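(* Let $X$ be a Hausdorff separable space which is radial with respect to dense subspaces. Then: (1) $X$ is R-separable. (2) If, in addition, $X$ does not have isolated points, then $X$ is GN-separable.
   Context: Spaces are non-empty. A well-ordered net $\{x_\alpha:\alpha<\kappa\}$ ($\kappa$ a cardinal) converges to $p$ if for every neighborhood $U$ of $p$ there is $\beta<\kappa$ such that $x_\alpha\in U$ for all $\alpha$ with $\beta\le\alpha<\kappa$. A space $X$ is radial if for every $A\subset X$ and every $p\in\overline{A}$ there is a well-ordered net $\{x_\alpha:\alpha<\kappa\}\subset A$ converging to $p$; $X$ is radial with respect to dense subspaces if this holds for every dense $A\subset X$ (and every $p\in X$). $X$ is R-separable if for every sequence $(D_n:n\in\omega)$ of dense subspaces of $X$ one can pick points $p_n\in D_n$ so that $\{p_n:n\in\omega\}$ is dense in $X$. $X$ is GN-separable if $X$ is crowded (has no isolated points) and for every sequence $(D_n:n\in\omega)$ of dense subspaces of $X$ one can pick points $p_n\in D_n$ so that $\{p_n:n\in\omega\}$ is groupable, meaning that there are pairwise disjoint non-empty finite sets $A_m$ ($m\in\omega$) such that $\{p_n:n\in\omega\}=\bigcup_{m\in\omega}A_m$ and every non-empty open set in $X$ intersects all but finitely many $A_m$. *)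

(* Defs.v *)
From mathcomp Require Import all_boot.
From mathcomp Require Import boolp classical_sets functions cardinality wochoice.
From mathcomp Require Import topology.

Set Implicit Arguments.
Unset Strict Implicit.
Unset Printing Implicit Defensive.

Local Open Scope classical_set_scope.
Local Open Scope card_scope.

Definition separable_space (X : topologicalType) :=
  exists2 D : set X, countable D & dense D.

(* A cardinal kappa = {alpha : alpha < kappa} is represented, up to order
   isomorphism, by a type K with a reflexive well-order le that is an initial
   ordinal: no proper initial segment of K has the cardinality of K. *)
Definition cardinal_order (K : Type) (le : rel K) :=
  well_order le /\
  forall a : K, ~ ([set: K] #<= [set b : K | le b a /\ b <> a]).

Definition net_converges (K : Type) (le : rel K) (X : topologicalType)
    (x : K -> X) (p : X) :=
  forall U : set X, nbhs p U ->
    exists b : K, forall a : K, le b a -> U (x a).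

Definition radial_at (X : topologicalType) (A : set X) (p : X) :=
  exists (K : Type) (le : rel K) (x : K -> X),
    [/\ cardinal_order le, forall a, A (x a) & net_converges le x p].

Definition radial_wrt_dense (X : topologicalType) :=
  forall A : set X, dense A -> forall p : X, radial_at A p.

Definition R_separable (X : topologicalType) :=
  forall D : nat -> set X, (forall n, dense (D n)) ->
    exists p : nat -> X, (forall n, D n (p n)) /\ dense (range p).

Definition crowded (X : topologicalType) := isolated [set: X] = set0.

Definition groupable (X : topologicalType) (S : set X) :=
  exists A : nat -> set X,
    [/\ trivIset [set: nat] A,
        forall m, A m !=set0 /\ finite_set (A m),
        S = \bigcup_m A m
      & forall U : set X, open U -> U !=set0 ->
          finite_set [set m | ~ (U `&` A m !=set0)]].

Definition GN_separable (X : topologicalType) :=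
  crowded X /\
  forall D : nat -> set X, (forall n, dense (D n)) ->
    exists p : nat -> X, (forall n, D n (p n)) /\ groupable (range p).

(* Main.v *)
Require Import Defs.
From mathcomp Require Import all_boot.
From mathcomp Require Import boolp classical_sets functions cardinality wochoice.
From mathcomp Require Import topology.

Local Open Scope classical_set_scope.

(** Let [q] be a non-isolated point and [d] an enumeration of a countable dense
    set.  Each [d n <> q] has an open neighbourhood [W n] whose complement is a
    neighbourhood of [q].  If all [D n] are dense, then so is the union [A] of
    the [D n `&` W n], and a well-ordered net in [A] converging to [q]
    eventually leaves every [W n].  Hence countably many indices are cofinal in
    the net, and it contains a sequence converging to [q] whose terms lie in
    sets [D n] with strictly increasing [n].  Applying this to every [q = d i],
    with the given dense sets split into countably many sequences, yields
    R-separability.  When no point is isolated these sequences avoid their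
    limits, so they leave every finite set; the blocks of the groupable set are
    then built recursively, the [m]-th one containing a late new term of each of
    the first [m + 1] sequences. *)

(** * Well-orders and well-ordered nets *)

Section WellOrder.
Context {K : Type} {le : rel K}.
Context (le_wo : well_order le).

(** [well_order] only provides a unique minimum for each non-empty predicate, so the order axioms
    are recovered from minima of sets with two or three elements. *)
Lemma well_order_total : total le.
Proof.
move=> x y; have [|z [[]]] := le_wo (fun w => `[< w = x \/ w = y >]).
  by exists x; apply/asboolP; left.
move=> /asboolP[] -> zmin _; apply/orP.
  by left; apply: zmin; apply/asboolP; right.
by right; apply: zmin; apply/asboolP; left.
Qed.

Lemma well_order_antisymmetric : antisymmetric le.
Proof.
have le_refl x : le x x by have := well_order_total x x; rewrite orbb.
move=> x y /andP[xy yx].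
have [|z [_ zuniq]] := le_wo (fun w => `[< w = x \/ w = y >]).
  by exists x; apply/asboolP; left.
have zx : z = x.
  by apply: zuniq; split=> [|w /asboolP[] ->//]; apply/asboolP; left.
rewrite -zx; apply: zuniq.
by split=> [|w /asboolP[] ->//]; apply/asboolP; right.
Qed.

Lemma well_order_transitive : transitive le.
Proof.
move=> y x z xy yz.
have [|w [[]]] := le_wo (fun w => `[< [\/ w = x, w = y | w = z] >]).
  by exists x; apply/asboolP; constructor 1.
move=> /asboolP[] -> wmin _.
- by apply: wmin; apply/asboolP; constructor 3.
- have yx : le y x by apply: wmin; apply/asboolP; constructor 1.
  by rewrite (@well_order_antisymmetric x y) // xy yx.
- have zy : le z y by apply: wmin; apply/asboolP; constructor 2.
  by rewrite (@well_order_antisymmetric z y) // zy yz.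
Qed.

Lemma well_order_finite_ub (b : nat -> K) (m : nat) :
  exists z, forall n, (n <= m)%N -> le (b n) z.
Proof.
have le_refl x : le x x by have := well_order_total x x; rewrite orbb.
elim: m => [|m [z zub]]; first by exists (b 0%N) => n; rewrite leqn0 => /eqP ->.
case/orP: (well_order_total z (b m.+1)) => zb.
- exists (b m.+1) => n; rewrite leq_eqVlt => /predU1P[->//|nm].
  by apply: well_order_transitive zb; apply: zub.
- by exists z => n; rewrite leq_eqVlt => /predU1P[->//|]; apply: zub.
Qed.

Lemma net_extract_sequence {X : topologicalType} {x : K -> X} {q : X}
    {B : nat -> set X} :
    net_converges le x q -> (forall n, nbhs q (~` B n)) ->
    (forall a, (\bigcup_n B n) (x a)) ->
  exists z : nat -> X,
    [/\ range z `<=` range x, z n @[n --> \oo] --> q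
      & forall m n, (n <= m)%N -> ~ B n (z m)].
Proof.
move=> xq qB xB.
have [b bB] := choice (fun n => xq _ (qB n)).
have [z zub] := choice (well_order_finite_ub b).
exists (x \o z); split.
- by move=> _ [m _ <-]; exists (z m).
- move=> U /xq[c cU].
  (* Cofinality of [b]: [x c] lies in some [B n], which the net avoids from [b n] on, so [c]
     precedes [b n]. *)
  have [n nbc] : exists n, ~~ le (b n) c.
    by have [n _ Bn] := xB c; exists n; apply/negP => /bB.
  exists n => // m /= nm; apply: cU.
  apply: (@well_order_transitive (b n)); last exact: zub.
  by have := well_order_total (b n) c; rewrite (negbTE nbc).
- by move=> m n nm; apply: bB; apply: zub.
Qed.

End WellOrder.

Lemma iter_ltn_homo {i : nat -> nat} : (forall m, (m < i m)%N) ->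
  {homo (fun k => iter k i 0%N) : k l / (k < l)%N}.
Proof.
by move=> mi; apply: homo_ltn => [? ? ?|k]; [exact: ltn_trans|exact: mi].
Qed.

(** * Convergent selections from dense sets *)

Section Radial.
Context {X : topologicalType}.
Context (X_hausdorff : hausdorff_space X).
Context (X_radial : radial_wrt_dense X).

Lemma hausdorff_nbhs_separation {q d : X} : d <> q ->
  exists2 W : set X, open W & W d /\ nbhs q (~` W).
Proof.
move=> /eqP dq; have := X_hausdorff; rewrite open_hausdorff => /(_ _ _ dq).
case=> -[/= W V] [/set_mem Wd /set_mem Vq] [oW oV /eqP WV0].
exists W => //; split=> //; apply: (@filterS _ _ _ V) => [y Vy Wy|].
  by have : (W `&` V) y by []; rewrite WV0.
exact: open_nbhs_nbhs.
Qed.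

Lemma nonisolated_setD1 {q : X} {U : set X} : ~ isolated [set: X] q ->
  open U -> U !=set0 -> open (U `\ q) /\ U `\ q !=set0.
Proof.
move=> q_lim oU [u Uu]; split.
  apply: openI => //; apply: closed_openC; apply: accessible_closed_set1.
  exact: hausdorff_accessible.
apply/set0P/eqP => Uq0; apply: q_lim; split; first exact: in_setT.
have Usub y : U y -> y = q.
  by move=> Uy; apply: contrapT => yq; have : (U `\ q) y by []; rewrite Uq0.
have Uq : U q by rewrite -(Usub u).
exists U; first exact: open_nbhs_nbhs.
by rewrite setIT; apply/seteqP; split=> y /= => [/Usub|->].
Qed.

Lemma dense_selection_cvg {d : nat -> X} {D : nat -> set X} {q : X} :
    dense (range d) -> (forall n, dense (D n)) -> ~ isolated [set: X] q ->
  exists y z : nat -> X,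
    [/\ forall n, D n (y n), range z `<=` range y, z n @[n --> \oo] --> q
      & forall n, z n <> q].
Proof.
move=> d_dense D_dense q_lim.
have /choice[W WP] : forall n, exists W : set X,
    [/\ open W, nbhs q (~` W) & d n <> q -> W (d n)].
  move=> n; have [dq|/hausdorff_nbhs_separation[W oW [Wd qW]]] :=
    pselect (d n = q); last by exists W.
  (* If [d n = q], the empty set serves: the density of the union below uses only those [d n] that
     differ from [q]. *)
  by exists set0; rewrite setC0; split=> //; [exact: open0|exact: filterT].
pose B n := D n `&` W n.
have qB n : nbhs q (~` B n).
  by have [_ + _] := WP n; apply: filterS => y nWy [].
have B_dense : dense (\bigcup_n B n).
  move=> U U0 oU; have [oUq Uq0] := nonisolated_setD1 q_lim oU U0.
  have [x [[Udn dnq] [n _ dnx]]] := d_dense _ Uq0 oUq; subst x.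
  have [oW _ /(_ dnq) Wd] := WP n.
  have [y [[Uy Wy] Dy]] : (U `&` W n) `&` D n !=set0.
    by apply: D_dense; [exists (d n)|exact: openI].
  by exists y; split=> //; exists n.
have [K [le [x [[le_wo _] xB xq]]]] := X_radial _ B_dense q.
have [z [zx zq zB]] := net_extract_sequence le_wo xq qB xB.
have /choice[i iP] : forall m, exists i, B i (z m).
  by move=> m; have [a _ <-] := zx _ (imageT z m);
    have [n _ Bn] := xB a; exists n.
(* [z m] avoids [B n] for all [n <= m] but lies in [B (i m)]. *)
have mi m : (m < i m)%N by rewrite ltnNge; apply/negP => /zB; apply; exact: iP.
(* Several [z m] may share an index [i m]; along [g], the indices
   [i (g k) = g k.+1] are pairwise distinct. *)
pose g k := iter k i 0%N.
have g_homo := iter_ltn_homo mi.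
have g_inj : injective (g \o succn).
  move=> k l; rewrite /comp => gkl; have [kl|lk|//] := ltngtP k l.
    by have := g_homo k.+1 l.+1 kl; rewrite -/(g k.+1) gkl ltnn.
  by have := g_homo l.+1 k.+1 lk; rewrite -/(g l.+1) -gkl ltnn.
(* At an index [g k.+1] the choice is forced to be [z (g k)]; elsewhere any point of [D n] will
   do. *)
have /choice[y yP] : forall n, exists y, D n y /\
    forall k, g k.+1 = n -> y = z (g k).
  move=> n; have [[k <-]|nk] := pselect (exists k, g k.+1 = n).
    by exists (z (g k)); split; [have [] := iP (g k)|move=> l /g_inj ->].
  have [y [_ Dy]] := D_dense n setT (ex_intro _ q Logic.I) openT.
  by exists y; split=> // k gk; case: nk; exists k.
have k_le_g k : (k <= g k)%N.
  by elim: k => // k IH; apply: leq_ltn_trans IH _; apply: g_homo.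
exists y, (z \o g); split.
- by move=> n; have [] := yP n.
- by move=> _ [k _ <-]; exists (g k.+1) => //; have [_ /(_ k) ->] := yP (g k.+1).
- move=> U /zq[N _ NU]; exists N => // k /= Nk.
  by apply: NU; apply: leq_trans (k_le_g k).
- by move=> k /= zkq; have := nbhs_singleton (qB (i (g k))); rewrite -zkq; apply.
Qed.

Lemma dense_isolated {D : set X} {q : X} :
  dense D -> isolated [set: X] q -> D q.
Proof.
move=> D_dense [_ [V qV]]; rewrite setIT => VE.
have [|y [/interior_subset Vy Dy]] := D_dense _ _ (open_interior V).
  by exists q.
by rewrite VE in Vy; rewrite -Vy.
Qed.

(** The pairing [pickle (i, n)] reserves infinitely many of the sets [D] for each [d i]. An isolated
    [d i] lies in every dense set, so a constant sequence works there. *)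
Lemma dense_simultaneous_selection_cvg {d : nat -> X} {D : nat -> set X} :
    dense (range d) -> (forall n, dense (D n)) ->
  exists (p : nat -> X) (z : nat -> nat -> X),
    [/\ forall n, D n (p n), forall i, range (z i) `<=` range p,
        forall i, z i n @[n --> \oo] --> d i
      & forall i, ~ isolated [set: X] (d i) -> forall n, z i n <> d i].
Proof.
move=> d_dense D_dense.
have /choice[yz yzP] : forall i, exists yz : (nat -> X) * (nat -> X),
    [/\ forall n, D (pickle (i, n)) (yz.1 n),
        range yz.2 `<=` range yz.1, yz.2 n @[n --> \oo] --> d i
      & ~ isolated [set: X] (d i) -> forall n, yz.2 n <> d i].
  move=> i; have [iso|lim] := pselect (isolated [set: X] (d i)).
    exists (fun=> d i, fun=> d i); split=> //=; last exact: cvg_cst.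
    by move=> n; apply: dense_isolated.
  have [y [z [Dy zy zd zn]]] := dense_selection_cvg d_dense
    (fun n => D_dense (pickle (i, n))) lim.
  by exists (y, z).
have /choice[p pP] : forall n, exists p, D n p /\
    forall i k, pickle (i, k) = n -> p = (yz i).1 k.
  move=> n; have [[[i k] <-]|no] :=
      pselect (exists ik : nat * nat, pickle ik = n).
    exists ((yz i).1 k); split; first by have [] := yzP i.
    by move=> j l /(pcan_inj pickleK)[-> ->].
  have [y [_ Dy]] := D_dense n setT (ex_intro _ (d 0%N) Logic.I) openT.
  by exists y; split=> // i k E; case: no; exists (i, k).
exists p, (fun i => (yz i).2); split.
- by move=> n; have [] := pP n.
- move=> i x; have [_ zy _ _] := yzP i; move=> /zy[k _ <-].
  by exists (pickle (i, k)) => //; have [_ /(_ i k) ->] := pP (pickle (i, k)).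
- by move=> i; have [] := yzP i.
- by move=> i; have [] := yzP i.
Qed.

End Radial.

(** * Recursive construction of the blocks *)

Lemma groupable_range {X : topologicalType} {p : nat -> X}
    {z : nat -> nat -> X} :
    (forall i, range (z i) `<=` range p) ->
    (forall i (F : seq X), \forall n \near \oo, z i n \notin F) ->
    (forall U, open U -> U !=set0 ->
      exists i, \forall n \near \oo, U (z i n)) ->
  groupable (range p).
Proof.
move=> zp zF zU.
(* Given the list [F] of points already used, the block [s] consists of new points: [p m] unless it
   is in [F], so that the blocks exhaust the range, and a term of index at least [m] from each of
   the sequences [0] to [m]. *)
have step_ex (mF : nat * seq X) : exists s : seq X,
    [/\ [set` s] `<=` range p, forall x, x \in s -> x \notin mF.2,
        p mF.1 \in mF.2 ++ s
      & forall i, (i <= mF.1)%N -> exists2 k, (mF.1 <= k)%N & z i k \in s].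
  case: mF => m F /=.
  have /choice[k kP] : forall i, exists k, (m <= k)%N /\ z i k \notin F.
    move=> i; have [N _ NF] := zF i F.
    by exists (maxn m N); split; [exact: leq_maxl|apply: NF; exact: leq_maxr].
  exists ([seq x <- [:: p m] | x \notin F] ++ [seq z i (k i) | i <- iota 0 m.+1]).
  split.
  - move=> x xs; have : x \in _ ++ _ := xs.
    rewrite mem_cat => /orP[|/mapP[i _ ->]].
      by rewrite mem_filter inE => /andP[_ /eqP ->]; exists m.
    by apply: (zp i); exists (k i).
  - move=> x; rewrite mem_cat mem_filter => /orP[/andP[]//|/mapP[i _ ->]].
    by have [] := kP i.
  - by rewrite !mem_cat mem_filter inE eqxx andbT; case: (p m \in F).
  - move=> i im; exists (k i); first by have [] := kP i.
    by rewrite mem_cat map_f ?orbT // mem_iota.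
have [step stepP] := choice step_ex.
pose used := fix used m := if m is n.+1 then used n ++ step (n, used n) else [::].
pose block m := step (m, used m).
have used_le m n : (m <= n)%N -> {subset used m <= used n}.
  elim: n => [|n IH]; first by rewrite leqn0 => /eqP ->.
  rewrite leq_eqVlt => /predU1P[->//|/IH mn] x xm.
  by rewrite /= mem_cat mn.
have used_block m x : x \in used m -> exists n, x \in block n.
  elim: m => // m IH; rewrite /= mem_cat => /orP[/IH//|xm].
  by exists m.
exists (fun m => [set` block m]); split.
- apply: ltn_trivIset => n m mn; apply/seteqP; split=> // x [/= xm xn].
  have [_ /(_ _ xn) /negP + _ _] := stepP (n, used n); apply=> /=.
  by apply: (used_le m.+1) => //=; rewrite mem_cat xm orbT.
- move=> m; split; last by apply/finite_seqP; exists (block m).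
  have [_ _ _ /(_ 0%N (leq0n _)) [k _ zk]] := stepP (m, used m).
  by exists (z 0%N k).
- apply/seteqP; split=> x.
    move=> [m _ <-]; have [_ _ + _] := stepP (m, used m); rewrite /= => pm.
    by have [n xn] := used_block m.+1 _ pm; exists n.
  by move=> [m _ xm]; have [+ _ _ _] := stepP (m, used m); apply.
- move=> U oU U0; have [i [N _ NU]] := zU U oU U0.
  (* Once [m] reaches both [i] and [N], block [m] contains a term of [z i] of index at least [N],
     which lies in [U]. *)
  apply: (@sub_finite_set _ _ `I_(maxn i N)); last exact: finite_II.
  move=> m /= mU; rewrite ltnNge; apply/negP; rewrite geq_max => /andP[im Nm].
  have [_ _ _ /(_ i im) [k mk zk]] := stepP (m, used m).
  by apply: mU; exists (z i k); split=> //; apply: NU; apply: leq_trans mk.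
Qed.

Lemma separable_enumeration {X : topologicalType} :
  [set: X] !=set0 -> separable_space X -> exists d : nat -> X, dense (range d).
Proof.
move=> X0 [S /pfcard_geP[S0|[d]] S_dense].
  by have [x []] := S_dense _ X0 openT; rewrite S0.
exists d => U U0 oU; have [x [Ux Sx]] := S_dense U U0 oU.
exists x; split=> //; have [n _ <-] := @surj _ _ _ _ d x Sx.
by exists n.
Qed.

Theorem proposition2 (X : topologicalType) (X_nonempty : [set: X] !=set0)
    (X_hausdorff : hausdorff_space X) (X_separable : separable_space X)
    (X_radial : radial_wrt_dense X) :
  R_separable X /\ (isolated [set: X] = set0 -> GN_separable X).
Proof.
have [d d_dense] := separable_enumeration X_nonempty X_separable.
have near_dense (z : nat -> nat -> X) : (forall i, z i n @[n --> \oo] --> d i) ->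
    forall U, open U -> U !=set0 -> exists i, \forall n \near \oo, U (z i n).
  move=> zd U oU U0; have [x [Ux [i _ dix]]] := d_dense U U0 oU.
  by exists i; apply: zd; apply: open_nbhs_nbhs; split=> //; rewrite dix.
split=> [D D_dense|X_crowded].
  have [p [z [Dp zp zd _]]] :=
    dense_simultaneous_selection_cvg X_hausdorff X_radial d_dense D_dense.
  exists p; split=> // U U0 oU.
  have [i [N _ NU]] := near_dense z zd U oU U0.
  by exists (z i N); split; [exact: NU (leqnn N)|apply: zp; exists N].
split=> // D D_dense.
have [p [z [Dp zp zd zNd]]] :=
  dense_simultaneous_selection_cvg X_hausdorff X_radial d_dense D_dense.
exists p; split=> //; apply: groupable_range zp _ (near_dense z zd) => i F.
(* [F] may contain [d i], so convergence only helps to avoid the rest of [F]; the value [d i] itself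
   is never taken because no point is isolated. *)
have dF : nbhs (d i) (~` ([set` F] `\ d i)).
  apply: open_nbhs_nbhs; split; last by move=> [_]; apply.
  apply: closed_openC.
  apply: (accessible_finite_set_closed.1 (hausdorff_accessible X_hausdorff)).
  by apply: finite_setD; apply/finite_seqP; exists F.
have [N _ NF] := zd i _ dF; exists N => // n /NF /= nF.
apply/negP => zF; apply: nF; split=> //; apply: zNd.
by rewrite X_crowded.
Qed.
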